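(* For all integers $d\ge 3$ and $n\ge d+3$, \[ \mathsf{M}_d(n)\ \ge\ \binom{n-1}{d}+\binom{n-4}{d-2}+\mathsf{M}_{d-3}(n-5). \]
   Context: For a finite set $X$ and an integer $r\ge 0$, $\binom{X}{r}=\{A\subseteq X: |A|=r\}$; $[n]=\{1,\dots,n\}$. For a family $\mathcal F\subseteq 2^X$ and $S\subseteq X$, the trace of $\mathcal F$ on $S$ is $\mathcal F\!\upharpoonright_S=\{F\cap S: F\in\mathcal F\}$. The set $S$ is shattered by $\mathcal F$ if $\mathcal F\!\upharpoonright_S=2^S$, and the VC-dimension $\operatorname{VC}(\mathcal F)$ is the maximum cardinality of a set shattered by $\mathcal F$. For integers $d\ge 0$ and $n\ge d+1$, define \[ \mathsf{M}_d(n)=\max\left\{|\mathcal F| : \mathcal F\subseteq\binom{[n]}{d+1},\ \operatorname{VC}(\mathcal F)\le d\right\}. \] *)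

(* Defs.v *)
From mathcomp Require Import all_boot.

Set Implicit Arguments.
Unset Strict Implicit.
Unset Printing Implicit Defensive.

Section VC.

Variable T : finType.
Implicit Types (F : {set {set T}}) (S : {set T}).

Definition trace F S : {set {set T}} := [set A :&: S | A in F].

Definition shatters F S : bool := trace F S == powerset S.

(* The empty family shatters no set; its VC-dimension is 0 here, the value
   of an empty \max. *)
Definition VCdim F : nat := \max_(S : {set T} | shatters F S) #|S|.

Definition uniform (r : nat) F : bool := [forall A in F, #|A| == r].

End VC.

(* The ground set [n] is represented by 'I_n. The maximum is over a nonempty
   range, since the empty family qualifies. *)
Definition maxVC (d n : nat) : nat :=
  \max_(F : {set {set 'I_n}} | uniform d.+1 F && (VCdim F <= d)) #|F|.

(* Main.v *)
Require Import Defs.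
From mathcomp Require Import all_boot.
From mathcomp Require Import zify.

(** A [k]-uniform family has VC-dimension below [k] as soon as each member [A]
has a hole: a subset [B] of [A] that is not the trace on [A] of any member
([VCdim_leP]).  So it is enough to build a large uniform family together with
a hole in each of its members.

With [k = d + 1], split the ground set into five distinguished points and
[m = n - 5] others.  A set [A] is then a pair of its profile [t] (its trace on
the five points) and its rest [R].  Take all [k]-sets whose profile lies in
a fixed list [core] of 18 patterns.  To see that [A] has a hole, look for one
of the form [b] together with the whole of [R], where [b] is a subset of [t].
A member [A'] with this trace contains [R], so, all members having the same
size, its profile has size at most [#|t|].  Hence it is enough that [b] not be
the trace on [t] of a core pattern of size at most [#|t|], a condition on
subsets of a five-point set that is verified by computation.  The core has
1, 4, 7, 5, 1 patterns of sizes 1, 2, 3, 4, 5, and the number of [k]-sets with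
these profiles is ['C(n-1, d) + 'C(n-4, d-2)] by Pascal's rule
([pascal_core]).

The last summand comes from an eighth triple, [extra], used with rests taken
only from an optimal family [H] of [(k-3)]-sets. It has a hole itself, and
adding it costs only one other pattern its hole: on the triple [123] the sole
trace missing from the core is [{3}], and this is exactly the trace of
[extra]. If [A] has profile [123] and rest [R] in [H], the hole is [{3}]
together with a hole [C] of [R] in [H]: whatever its size, no core pattern
traces [{3}] on [123], so a member with this trace has profile [extra], hence
rest in [H], and that rest cannot trace [C] on [R]. If [R] is not in [H], then
[{3}] together with [R] is still a hole, since a member with profile [extra]
whose rest contains [R] would have rest [R] ([VCdim_family]). *)

Set Implicit Arguments.
Unset Strict Implicit.
Unset Printing Implicit Defensive.

(** * Holes in uniform families *)

(** A shattered set is a trace of itself, hence contained in a member; if it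
has the uniform size it is that member, and shattering says that it has no
hole. *)
Lemma VCdim_leP (T : finType) (F : {set {set T}}) k : uniform k.+1 F ->
  reflect (forall A, A \in F -> exists2 B : {set T}, B \subset A &
                       forall A', A' \in F -> A' :&: A != B)
          (VCdim F <= k).
Proof.
move=> /forall_inP unifF; apply: (iffP idP) => [VCk A FA | misses].
  have /negP nshA : ~~ shatters F A.
    apply: contraL VCk => shA; rewrite -ltnNge -(eqP (unifF A FA)).
    exact: (leq_bigmax_cond (F := fun S : {set T} => #|S|)).
  have sub : trace F A \subset powerset A.
    by apply/subsetP => _ /imsetP[A' _ ->]; rewrite inE subsetIr.
  have /subsetPn[B] : ~~ (powerset A \subset trace F A).
    by apply/negP => sup; apply: nshA; rewrite /shatters eqEsubset sub.
  rewrite inE => sBA trB; exists B => // A' FA'.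
  by apply: contraNneq trB => <-; apply: imset_f.
apply/bigmax_leqP => S /eqP shS; rewrite leqNgt; apply/negP => ltkS.
have : S \in trace F S by rewrite shS inE.
case/imsetP => A FA defS.
have sSA : S \subset A by rewrite defS subsetIl.
have eqSA : S = A.
  by apply/eqP; rewrite eqEcard sSA (eqP (unifF A FA)).
have [B sBA missB] := misses A FA.
have : B \in trace F S by rewrite shS inE eqSA.
by case/imsetP => A' FA' defB; move: (missB A' FA'); rewrite defB eqSA eqxx.
Qed.

(** * Splitting the ground set *)

Section Split.

Variables s m : nat.
Implicit Types (A B : {set 'I_(s + m)}) (R : {set 'I_m}) (t b : seq nat).

(** The trace on the first [s] points is recorded as an increasing list of
numbers, so that statements about patterns can be decided by evaluation. *)
Definition profile A : seq nat := [seq val i | i <- enum 'I_s & lshift m i \in A].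

Definition rest A : {set 'I_m} := [set j | rshift s j \in A].

Definition glue t R : {set 'I_(s + m)} :=
  [set x | match split x with inl i => val i \in t | inr j => j \in R end].

Lemma lshift_glue t R i : (lshift m i \in glue t R) = (val i \in t).
Proof. by rewrite inE (unsplitK (inl i)). Qed.

Lemma rshift_glue t R j : (rshift s j \in glue t R) = (j \in R).
Proof. by rewrite inE (unsplitK (inr j)). Qed.

Lemma mem_profile A i : (val i \in profile A) = (lshift m i \in A).
Proof. by rewrite (mem_map val_inj) mem_filter mem_enum andbT. Qed.

Lemma rest_glue t R : rest (glue t R) = R.
Proof. by apply/setP => j; rewrite inE rshift_glue. Qed.

(** The subsequences of [iota 0 s] are the increasing lists of numbers below
[s], that is, the lists that can be profiles. *)
Lemma profile_glue t R : subseq t (iota 0 s) -> profile (glue t R) = t.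
Proof.
move=> sub; rewrite /profile (eq_filter (a2 := preim val (mem t))); last first.
  by move=> i; rewrite lshift_glue.
rewrite -filter_map val_enum_ord.
by apply/esym/(subseq_uniqP (iota_uniq 0 s)).
Qed.

Lemma rest_setI A B : rest (A :&: B) = rest A :&: rest B.
Proof. by apply/setP => j; rewrite !inE. Qed.

Lemma profile_setI A B : profile (A :&: B) = [seq i <- profile A | i \in profile B].
Proof.
rewrite {1 2}/profile [RHS]filter_map -[in RHS]filter_predI.
apply: (congr1 (map val)); apply: eq_filter => i.
by rewrite !inE /= mem_profile andbC.
Qed.

Lemma card_profile_rest A : #|A| = size (profile A) + #|rest A|.
Proof.
rewrite -!sum1_card [LHS]big_mkcond big_split_ord /= size_map size_filter.
congr (_ + _); last first.
  by rewrite [RHS]big_mkcond; apply: eq_bigr => j _; rewrite inE.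
by rewrite -sum1_count big_enum_cond -big_mkcondr.
Qed.

Lemma glue_sub b R A :
  subseq b (profile A) -> R \subset rest A -> glue b R \subset A.
Proof.
move=> sub /subsetP sRA; apply/subsetP => x.
rewrite inE -{2}(splitK x); case: (split x) => [i /(mem_subseq sub) | j /sRA] /=.
  by rewrite mem_profile.
by rewrite inE.
Qed.

Lemma card_fiber k t : subseq t (iota 0 s) -> size t <= k ->
  'C(m, k - size t) <= #|[set A | profile A == t & #|A| == k]|.
Proof.
move=> sub letk; rewrite -[m in 'C(m, _)]card_ord -card_draws.
rewrite -(card_imset _ (can_inj (rest_glue t))); apply: subset_leq_card.
apply/subsetP => _ /imsetP[R cR ->]; rewrite inE in cR.
by rewrite inE card_profile_rest profile_glue // rest_glue eqxx (eqP cR) subnKC /=.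
Qed.

(** The restriction [size t <= k] matters because of truncated subtraction:
a longer pattern has an empty fiber, but ['C(m, k - size t)] would be 1. *)
Lemma card_pattern (L : seq (seq nat)) k :
  uniq L -> all (subseq^~ (iota 0 s)) L ->
  \sum_(t <- L | size t <= k) 'C(m, k - size t)
    <= #|[set A | profile A \in L & #|A| == k]|.
Proof.
elim: L => [|t L IH] /=; first by rewrite big_nil.
case/andP => tL uL /andP[subt subL]; rewrite big_cons.
have -> : [set A | profile A \in t :: L & #|A| == k] =
    [set A | profile A == t & #|A| == k] :|: [set A | profile A \in L & #|A| == k].
  by apply/setP => A; rewrite !inE andb_orl.
have dis : [disjoint [set A | profile A == t & #|A| == k]
                   & [set A | profile A \in L & #|A| == k]].
  rewrite disjoint_subset; apply/subsetP => A; rewrite !inE => /andP[/eqP-> _].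
  by rewrite (negPf tL).
have /eqP-> := etrans (leq_card_setU _ _).2 dis.
have {}IH := IH uL subL; case: ifP => [letk | _].
  by rewrite leq_add ?card_fiber.
exact: leq_trans IH (leq_addl _ _).
Qed.

End Split.

(** * The patterns on five points *)

(** The choice is governed by the need for holes: all sets of size at least 4
keep one, but a pair or a triple loses the empty set as a possible hole once
a core pattern avoids it, so pairs and triples can be admitted only sparingly.
The pairs form a spanning tree, with 0 and 1 as its inner vertices. *)
Definition core : seq (seq nat) :=
  [:: [:: 0];
      [:: 0; 1]; [:: 0; 2]; [:: 1; 3]; [:: 1; 4];
      [:: 0; 1; 2]; [:: 0; 1; 3]; [:: 0; 1; 4]; [:: 0; 2; 3];
      [:: 1; 2; 3]; [:: 1; 3; 4]; [:: 2; 3; 4];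
      [:: 0; 1; 2; 3]; [:: 0; 1; 2; 4]; [:: 0; 1; 3; 4]; [:: 0; 2; 3; 4];
      [:: 1; 2; 3; 4];
      [:: 0; 1; 2; 3; 4]].

Definition extra : seq nat := [:: 0; 3; 4].

(** A subset of the pattern [t] that is not the trace on [t] of any core
pattern of size at most [size t].  The default, the empty set, serves whenever
no such pattern is disjoint from [t]. *)
Definition hole (t : seq nat) : seq nat :=
  match t with
  | [:: 0; 2] | [:: 0; 2; 3] => [:: 2]
  | [:: 1; 3] | [:: 1; 2; 3] | [:: 1; 2; 3; 4] => [:: 3]
  | [:: 1; 4] | [:: 1; 3; 4] => [:: 4]
  | [:: 2; 3; 4] => [:: 2; 4]
  | _ => [::]
  end.

Definition meet (u t : seq nat) : seq nat := [seq i <- u | i \in t].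

Lemma hole_subseq t : t \in extra :: core -> subseq (hole t) t.
Proof. by move: t; apply/allP. Qed.

Lemma hole_core t u : t \in extra :: core -> u \in core ->
  size u <= size t -> meet u t != hole t.
Proof.
have /allrelP ok : allrel (fun t u => (size u <= size t) ==>
  (meet u t != hole t)) (extra :: core) core by [].
by move=> tc uc; apply/implyP; apply: ok.
Qed.

(** As [extra] has three elements, it only has to be kept out of the holes of
patterns of size at least 3. *)
Lemma hole_extra t : t \in extra :: core -> 3 <= size t -> t != [:: 1; 2; 3] ->
  meet extra t != hole t.
Proof.
have /allP ok : all (fun t => [&& 3 <= size t & t != [:: 1; 2; 3]] ==>
  (meet extra t != hole t)) (extra :: core) by [].
by move=> tc st neq; apply: implyP (ok t tc) _; rewrite st.
Qed.

(** In contrast with [hole_core], the size of [u] is not bounded: the hole of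
a set with profile 123 and rest in [H] does not contain the whole rest, so its
competitors may have profiles of any size. *)
Lemma meet_extra u : u \in core ->
  meet u [:: 1; 2; 3] != meet extra [:: 1; 2; 3].
Proof. by move: u; apply/allP. Qed.

Lemma sub_iota t : t \in extra :: core -> subseq t (iota 0 5).
Proof. by move: t; apply/allP. Qed.

(** The coefficients 1, 4, 7, 5, 1 count the core patterns by size.  For
[e = 0] the last term vanishes: members then have four elements,
and the pattern of size 5 has no member over it. *)
Lemma pascal_core m e :
  'C(m + 4, e + 3) + 'C(m + 1, e + 1) =
  'C(m, e.+3) + 4 * 'C(m, e.+2) + 7 * 'C(m, e.+1) + 5 * 'C(m, e) +
    (if e is f.+1 then 'C(m, f) else 0).
Proof.
by case: e => [|f]; rewrite addn4 addn3 !addn1 ?binS ?bin0; lia.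
Qed.

(** * The family *)

Section Family.

Variables (m e : nat) (H : {set {set 'I_m}}).
Hypotheses (unifH : uniform e.+1 H) (VCH : VCdim H <= e).

Definition family : {set {set 'I_(5 + m)}} :=
  [set A | (profile A \in core) || (profile A == extra) && (rest A \in H)
         & #|A| == e.+4].

Lemma uniform_family : uniform e.+4 family.
Proof. by apply/forall_inP => A; rewrite inE => /andP[]. Qed.

(** The hole of [A] contains the whole rest of [A], except when [A] has
profile 123 and its rest is in [H]; there the hole comes from one in [H]. *)
Lemma VCdim_family : VCdim family <= e.+3.
Proof.
apply/(VCdim_leP uniform_family) => A; rewrite inE => /andP[profA /eqP cardA].
have codeA : profile A \in extra :: core.
  by rewrite inE; case/orP: profA => [->|/andP[-> //]]; rewrite orbT.
case: (boolP ((profile A == [:: 1; 2; 3]) && (rest A \in H))) => [|special].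
  case/andP => /eqP hA tA; have [C sC missC] := VCdim_leP unifH VCH _ tA.
  exists (glue 5 (meet extra [:: 1; 2; 3]) C); first by rewrite glue_sub ?hA.
  move=> A' FA'; apply/eqP => eqB.
  have := congr1 (@profile 5 m) eqB; have := congr1 (@rest 5 m) eqB.
  rewrite rest_setI rest_glue profile_setI profile_glue // hA => eqC eqb.
  move: FA'; rewrite inE => /andP[/orP[/meet_extra neq|/andP[_ tA']] _].
    by rewrite /meet eqb eqxx in neq.
  by move: (missC _ tA'); rewrite eqC eqxx.
exists (glue 5 (hole (profile A)) (rest A)).
  by rewrite glue_sub ?hole_subseq.
move=> A' FA'; apply/eqP => eqB.
have := congr1 (@profile 5 m) eqB; have := congr1 (@rest 5 m) eqB.
rewrite rest_setI rest_glue profile_setI profile_glue; last first.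
  exact: subseq_trans (hole_subseq codeA) (sub_iota codeA).
move=> /setIidPr sAA' eqb.
move: FA'; rewrite inE => /andP[profA' /eqP cardA'].
have := subset_leq_card sAA'.
move: (cardA) (cardA'); rewrite !card_profile_rest => cA cA' lerest.
have leprof : size (profile A') <= size (profile A) by lia.
case/orP: profA' => [coreA'|/andP[/eqP eqpA' tA']].
  by move: (hole_core codeA coreA' leprof); rewrite /meet eqb eqxx.
rewrite eqpA' in leprof eqb.
(* Profiles of equal size force equal rests, so [rest A] would be in [H]. *)
have neq : profile A != [:: 1; 2; 3].
  apply: contraNneq special => hA; rewrite hA eqxx /=.
  have -> // : rest A = rest A'.
  by apply/eqP; rewrite eqEcard sAA' /=; rewrite hA eqpA' /= in cA cA'; lia.
by move: (hole_extra codeA leprof neq); rewrite /meet eqb eqxx.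
Qed.

Lemma card_family : 'C(m + 4, e + 3) + 'C(m + 1, e + 1) + #|H| <= #|family|.
Proof.
have cardH R : R \in H -> #|R| = e.+1 by move/(forall_inP unifH)/eqP.
have subx : subseq extra (iota 0 5) by [].
rewrite -(card_imset H (can_inj (@rest_glue 5 m extra))).
set FH := [set _ | _ in H].
pose FC := [set A : {set 'I_(5 + m)} | profile A \in core & #|A| == e.+4].
have dis : [disjoint FC & FH].
  rewrite disjoint_subset; apply/subsetP => A; rewrite inE => /andP[hA _].
  by apply: contraL hA => /imsetP[R _ ->]; rewrite profile_glue.
have sub : FC :|: FH \subset family.
  apply/subsetP => A; rewrite !inE => /orP[/andP[-> ->] //|/imsetP[R HR ->]].
  by rewrite card_profile_rest profile_glue // rest_glue HR (cardH R HR) eqxx orbT /=.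
apply: leq_trans (subset_leq_card sub).
have /eqP-> := etrans (leq_card_setU _ _).2 dis.
rewrite leq_add2r; apply: leq_trans (@card_pattern 5 m core e.+4 _ _) => //.
rewrite pascal_core unlock /=.
by case: e => [|f]; rewrite ?subSS ?subn0 /=; lia.
Qed.

End Family.

Theorem theorem1p1 (d n : nat) (hd : 3 <= d) (hn : d + 3 <= n) :
  'C(n - 1, d) + 'C(n - 4, d - 2) + maxVC (d - 3) (n - 5) <= maxVC d n.
Proof.
have -> : n = 5 + (n - 5) by lia.
have -> : d = (d - 3).+3 by lia.
move: (n - 5) (d - 3) => m e.
have -> : 5 + m - 1 = m + 4 by lia.
have -> : 5 + m - 4 = m + 1 by lia.
have -> : 5 + m - 5 = m by lia.
have -> : e.+3 - 3 = e by lia.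
have -> : e.+3 - 2 = e + 1 by lia.
have [|H /andP[unifH VCH] maxH] := @eq_bigmax_cond _
    (fun H : {set {set 'I_m}} => uniform e.+1 H && (VCdim H <= e))
    (fun H => #|H|).
  have unif0 : uniform e.+1 (set0 : {set {set 'I_m}}).
    by apply/forall_inP => A; rewrite inE.
  (* The maximum defining [maxVC] is attained only if its range is nonempty. *)
  apply/card_gt0P; exists set0; rewrite unfold_in /= unif0.
  by apply/(VCdim_leP unif0) => A; rewrite inE.
rewrite [maxVC e m]maxH.
apply: leq_trans (leq_bigmax_cond (F := fun F : {set {set _}} => #|F|) (family e H) _).
  by rewrite -[e.+3]addn3 card_family.
apply/andP; split; [exact: uniform_family | exact: VCdim_family].
Qed.
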